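(* Let $\mathcal{S}$ be a transitive temporal feedback graph on $T$ rounds with $K=2$ actions. Then every $\mathcal{S}$-learning algorithm $\mathcal{A}$ has worst-case regret $\mathrm{Reg}(\mathcal{A})\ge\mathsf{UB}(\mathcal{S})/50$.
   Context: Setting: $T$ rounds, actions $x_t\in\Delta_K$, losses $\ell_t\in[0,1]^K$. A temporal feedback graph $\mathcal{S}$ is a collection of subsets $S_t\subseteq[T]\setminus\{t\}$, viewed as a directed graph with edge $s\to t$ iff $s\in S_t$; it is transitive if this graph is acyclic and whenever $s\in S_t$ and $r\in S_s$ we have $r\in S_t$. An $\mathcal{S}$-learning algorithm chooses $x_t$ as a function of $(\ell_s)_{s\in S_t}$ only; its worst-case regret is $\mathrm{Reg}(\mathcal{A})=\max_{\boldsymbol\ell}\big(\sum_t\langle x_t,\ell_t\rangle-\min_{x^*\in\Delta_K}\sum_t\langle x^*,\ell_t\rangle\big)$. An order is a sequence $t_1,\dots,t_w$ with $t_u\in S_{t_v}$ for all $u<v$; maximal if no super-sequence is an order; $C_1,\dots,C_N$ are the maximal orders. $\mathsf{UB}(\mathcal{S})$ is the optimal value of: minimize $\sum_{c=1}^N\sqrt{\sum_{t\in C_c}\lambda_{c,t}^2}$ subject to $\sum_c\lambda_{c,t}=1$ for all $t$, $\lambda_{c,t}=0$ if $t\notin C_c$, $\lambda_{c,t}\ge0$. *)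

(* Defs.v *)
From HB Require Import structures.
From mathcomp Require Import all_boot all_order all_algebra.
From mathcomp Require Import boolp classical_sets reals.
Set Implicit Arguments. Unset Strict Implicit. Unset Printing Implicit Defensive.
Import Order.TTheory GRing.Theory Num.Theory.
Local Open Scope ring_scope.
Local Open Scope classical_set_scope.

Section TFG.
Variable R : realType.

Definition tfg (T : nat) := 'I_T -> {set 'I_T}.

Definition is_tfg T (S : tfg T) : Prop := forall t : 'I_T, t \notin S t.

Definition tfg_edge T (S : tfg T) : rel 'I_T := fun s t => s \in S t.

Definition tfg_acyclic T (S : tfg T) : Prop :=
  forall s t : 'I_T, s \in S t -> ~~ connect (tfg_edge S) t s.

Definition transitive_tfg T (S : tfg T) : Prop :=
  is_tfg S /\ tfg_acyclic S /\
  (forall r s t : 'I_T, s \in S t -> r \in S s -> r \in S t).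

Definition is_order T (S : tfg T) (s : seq 'I_T) : bool :=
  pairwise (fun u v => u \in S v) s.

Definition is_maximal_order T (S : tfg T) (s : seq 'I_T) : Prop :=
  is_order S s /\ forall s', is_order S s' -> subseq s s' -> s' = s.

(* the maximal orders, identified with their underlying sets of rounds *)
Definition maxorder_set T (S : tfg T) (C : {set 'I_T}) : bool :=
  `[< exists s, is_maximal_order S s /\ C = [set x in s] >].

Definition UB_feasible T (S : tfg T) (lam : {set 'I_T} -> 'I_T -> R) : Prop :=
  (forall t, \sum_(C | maxorder_set S C) lam C t = 1) /\
  (forall C t, maxorder_set S C -> t \notin C -> lam C t = 0) /\
  (forall C t, maxorder_set S C -> 0 <= lam C t).

Definition UB_obj T (S : tfg T) (lam : {set 'I_T} -> 'I_T -> R) : R :=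
  \sum_(C | maxorder_set S C) Num.sqrt (\sum_(t in C) lam C t ^+ 2).

Definition UB T (S : tfg T) : R :=
  inf [set UB_obj S lam | lam in UB_feasible S].

Definition in_simplex K (x : 'I_K -> R) : Prop :=
  (forall k, 0 <= x k) /\ \sum_k x k = 1.

Definition loss_seq T K (l : 'I_T -> 'I_K -> R) : Prop :=
  forall t k, 0 <= l t k <= 1.

Definition algorithm T K := 'I_T -> ('I_T -> 'I_K -> R) -> 'I_K -> R.

Definition is_S_learning T K (S : tfg T) (A : algorithm T K) : Prop :=
  (forall t l, loss_seq l -> in_simplex (A t l)) /\
  (forall t l l', loss_seq l -> loss_seq l' ->
     (forall s, s \in S t -> forall k, l s k = l' s k) ->
     forall k, A t l k = A t l' k).

Definition inner K (x y : 'I_K -> R) : R := \sum_k x k * y k.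

Definition regret T K (A : algorithm T K) (l : 'I_T -> 'I_K -> R) : R :=
  \sum_t inner (A t l) (l t) -
  inf [set \sum_t inner xs (l t) | xs in @in_simplex K].

Definition Reg T K (A : algorithm T K) : R :=
  sup [set regret A l | l in @loss_seq T K].

End TFG.

(* Main.v *)
Require Import Defs.
From HB Require Import structures.
From mathcomp Require Import all_boot all_order all_algebra.
From mathcomp Require Import boolp classical_sets reals.
From mathcomp Require Import fintype finset.
From mathcomp Require Import ring lra zify.
Import Order.TTheory GRing.Theory Num.Theory.
Local Open Scope ring_scope.

(* Duality.  Let p(z) be the value of the program defining UB with demand z_t in
   place of 1 and the constraint relaxed to >=.  It is sublinear, so Hahn-Banach
   gives a linear y <= p with y(1) = p(1) = UB; testing y on the vectors supported
   on one chain shows \sum_(t in C) y_t^2 <= 1 for every maximal order C, while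
   \sum_t y_t = UB.

   Adversary.  Round y_t to m_t / M.  Since \sum_(t in C) m_t^2 <= M^2 on chains,
   each round t can be given a block of m_t^2 among M^2 fair coins so that blocks of
   comparable rounds are disjoint (incomparable rounds may share coins).  The two
   losses at t are (1 +- Z_t) / 2, where Z_t is half the imaginary part of the Riesz
   product \prod (1 + 'i eps_k / (2 m_t)) over the block of t.  What the learner
   has seen is independent of the coins of t, so its expected loss is 1/2 per round.
   The comparator mixes the two actions according to the analogous half imaginary
   part G of \prod (1 + 'i eps_k / (2 M)) over all coins, and E[G Z_t] is at least
   m_t / (16 M); this gives regret at least UB / 32 in the limit M -> oo. *)

(** * Sublinear functionals and Hahn-Banach along finitely many directions *)

Section Sublinear.
Variables (R : realType) (V : lmodType R).
Implicit Types (p q : V -> R) (u v x y z : V).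

Definition sublinear p :=
  (forall x y, p (x + y) <= p x + p y) /\
  (forall a x, 0 <= a -> p (a *: x) <= a * p x).

(** For sublinear [p] this one equation makes [p] homogeneous and additive along [v]. *)
Definition linear_along p v := p (- v) = - p v.

Lemma sublinear0 p : sublinear p -> p 0 = 0.
Proof.
move=> [padd phom]; apply/le_anti/andP; split.
  by have := phom 0 0 (lexx 0); rewrite scale0r mul0r.
by have := padd 0 0; rewrite addr0 -subr_ge0 addrK.
Qed.

Lemma sublinear_opp p v : sublinear p -> - p (- v) <= p v.
Proof.
move=> sp; have [padd _] := sp; have := padd v (- v).
by rewrite subrr sublinear0 // -lerBlDr sub0r.
Qed.

(** Squeeze: [- q v <= q (- v) <= p (- v) = - p v]. Shrinking a functional thus keeps the linearity
    already gained. *)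
Lemma linear_along_le p q v : sublinear q -> (forall x, q x <= p x) ->
  linear_along p v -> q v = p v /\ linear_along q v.
Proof.
move=> sq qp lpv.
have h1 := qp v; have h2 := qp (- v); rewrite lpv in h2.
have h3 := sublinear_opp q v sq.
have qv : q v = p v by apply/le_anti/andP; split => //; lra.
by split=> //; rewrite /linear_along qv; apply/le_anti/andP; split => //; lra.
Qed.

Lemma linear_alongD p v x : sublinear p -> linear_along p v ->
  p (x + v) = p x + p v.
Proof.
move=> [padd _] lpv; apply/le_anti/andP; split; first exact: padd.
by have := padd (x + v) (- v); rewrite addrK lpv; lra.
Qed.

Lemma linear_alongZ p v a : sublinear p -> linear_along p v ->
  p (a *: v) = a * p v /\ linear_along p (a *: v).
Proof.
move=> sp lpv; have [padd phom] := sp.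
have main b : 0 <= b -> p (b *: v) = b * p v /\ linear_along p (b *: v).
  move=> b0; have h1 := phom b v b0; have h2 := phom b (- v) b0.
  rewrite lpv scalerN in h2.
  have h3 := sublinear_opp p (b *: v) sp.
  by rewrite /linear_along; split; apply/le_anti/andP; split => //; lra.
have [/main//|/ltW a0] := leP 0 a.
have [] := main (- a) ltac:(by rewrite oppr_ge0).
rewrite /linear_along !scaleNr !opprK => h1 h2.
have h3 : p (a *: v) = a * p v by lra.
by split=> //; lra.
Qed.

Lemma linear_along_sum p (I : Type) (r : seq I) (a : I -> R) (v : I -> V) :
  sublinear p -> (forall i, linear_along p (v i)) ->
  p (\sum_(i <- r) a i *: v i) = \sum_(i <- r) a i * p (v i).
Proof.
move=> sp lp; elim: r => [|i r IH]; first by rewrite !big_nil sublinear0.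
have [h1 h2] := linear_alongZ p (v i) (a i) sp (lp i).
by rewrite !big_cons addrC linear_alongD // IH h1 addrC.
Qed.

Lemma sublinearZ p a x : sublinear p -> 0 <= a -> p (a *: x) = a * p x.
Proof.
move=> sp; have [_ phom] := sp; rewrite le_eqVlt => /predU1P[<-|a0].
  by rewrite scale0r mul0r sublinear0.
apply/le_anti/andP; split; first exact: phom (ltW a0).
have ai : 0 <= a^-1 by rewrite invr_ge0 ltW.
have := phom _ (a *: x) ai.
by rewrite scalerA mulVf ?gt_eqF // scale1r mulrC ler_pdivlMr // mulrC.
Qed.

(* The largest sublinear functional below [p] whose value at [- v] is at most
   [- p v]: the one-dimensional extension step of Hahn-Banach. *)
Definition linearize p v z :=
  inf [set p (z + s *: v) - s * p v | s in [set s | 0 <= s]]%classic.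

Lemma linearize_le p v z s : sublinear p -> 0 <= s ->
  linearize p v z <= p (z + s *: v) - s * p v.
Proof.
move=> sp s0; apply: ge_inf; last by exists s.
(* Subadditivity on [(z + r *: v) + (- z)] shows that the set is bounded below. *)
exists (- p (- z)) => _ [r /= r0 <-].
have := sp.1 (z + r *: v) (- z).
by rewrite addrAC subrr add0r sublinearZ //; lra.
Qed.

Lemma le_linearize p v z b :
  (forall s, 0 <= s -> b <= p (z + s *: v) - s * p v) -> b <= linearize p v z.
Proof.
move=> h; apply: lb_le_inf; first by exists (p (z + 0 *: v) - 0 * p v), 0 => /=.
by move=> _ [s /= s0 <-]; exact: h.
Qed.

Lemma linearize_leid p v z : sublinear p -> linearize p v z <= p z.
Proof.
move=> sp; have := linearize_le p v z 0 sp (lexx 0).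
by rewrite scale0r addr0 mul0r subr0.
Qed.

Lemma sublinear_linearize p v : sublinear p -> sublinear (linearize p v).
Proof.
move=> sp; split=> [x y|a x].
  rewrite -lerBlDr; apply: le_linearize => s s0; rewrite lerBlDr -lerBlDl.
  apply: le_linearize => r r0; rewrite lerBlDl.
  have := linearize_le p v (x + y) (s + r) sp (addr_ge0 s0 r0).
  by have := sp.1 (x + s *: v) (y + r *: v); rewrite addrACA -scalerDl; lra.
rewrite le_eqVlt => /predU1P[<-|a0].
  by rewrite scale0r mul0r (le_trans (linearize_leid p v 0 sp)) ?sublinear0.
rewrite -ler_pdivrMl //; apply: le_linearize => s s0; rewrite ler_pdivrMl //.
have as0 : 0 <= a * s by rewrite mulr_ge0 // ltW.
apply: le_trans (linearize_le p v _ _ sp as0) _.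
by rewrite -scalerA -scalerDr sublinearZ ?(ltW a0) //; lra.
Qed.

Lemma linear_along_linearize p v : sublinear p -> linear_along (linearize p v) v.
Proof.
move=> sp; have sq := sublinear_linearize p v sp.
have h1 := linearize_le p v (- v) 1 sp ler01.
rewrite scale1r addNr sublinear0 // in h1.
have h2 := linearize_leid p v v sp.
have h3 := sublinear_opp _ v sq.
by rewrite /linear_along; apply/le_anti/andP; split; lra.
Qed.

Lemma linearize_id p v : sublinear p -> linearize p v v = p v.
Proof.
move=> sp; apply/le_anti; rewrite linearize_leid //=.
apply: le_linearize => s s0; rewrite -{2}(scale1r v) -scalerDl.
by rewrite sublinearZ ?addr_ge0 //; lra.
Qed.

(** One extension step per direction; later steps preserve earlier ones by [linear_along_le]. The
    first step is along [v] itself, which freezes the value there. *)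
Lemma hahn_banach_seq p v (vs : seq V) : sublinear p ->
  exists q, [/\ sublinear q, forall x, q x <= p x, q v = p v &
    forall u, u \in vs -> linear_along q u].
Proof.
move=> sp; suff [q [sq qp qv _ lq]] : exists q, [/\ sublinear q,
    forall x, q x <= p x, q v = p v, linear_along q v &
    forall u, u \in vs -> linear_along q u] by exists q.
elim: vs => [|w vs [q [sq qp qv lqv lq]]].
  exists (linearize p v); split=> //; first exact: sublinear_linearize.
  - by move=> x; exact: linearize_leid.
  - exact: linearize_id.
  - exact: linear_along_linearize.
exists (linearize q w); have sq' := sublinear_linearize q w sq.
have le_q x : linearize q w x <= q x by exact: linearize_leid.
have [e lv] := linear_along_le _ _ v sq' le_q lqv.
split=> //; first by move=> x; exact: le_trans (le_q x) (qp x).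
  by rewrite e.
move=> u; rewrite inE => /predU1P[->|uvs]; first exact: linear_along_linearize.
exact: (linear_along_le _ _ u sq' le_q (lq u uvs)).2.
Qed.

End Sublinear.

(** Minkowski's inequality. With norms [A], [B] nonzero, [(a i + b i) ^+ 2 <= (A + B) * (a i ^+ 2 /
    A + b i ^+ 2 / B)], and the right sides sum to [(A + B) ^+ 2]. *)
Lemma sqrt_sum_sqrD (R : realType) (I : finType) (P : pred I) (a b : I -> R) :
  Num.sqrt (\sum_(i | P i) (a i + b i) ^+ 2) <=
  Num.sqrt (\sum_(i | P i) a i ^+ 2) + Num.sqrt (\sum_(i | P i) b i ^+ 2).
Proof.
have sum0 (f : I -> R) : 0 <= \sum_(i | P i) f i ^+ 2.
  by apply: sumr_ge0 => i _; exact: sqr_ge0.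
have null (f : I -> R) : ~~ (0 < Num.sqrt (\sum_(i | P i) f i ^+ 2)) ->
    forall i, P i -> f i = 0.
  rewrite sqrtr_gt0 lt0r sum0 andbT negbK => /eqP /psumr_eq0P f0 i Pi.
  by apply/eqP; rewrite -sqrf_eq0 f0 // => j _; exact: sqr_ge0.
set A := Num.sqrt (\sum_(i | P i) a i ^+ 2).
set B := Num.sqrt (\sum_(i | P i) b i ^+ 2).
have [A0|/null a0] := boolP (0 < A); last first.
  rewrite (eq_bigr (fun i => b i ^+ 2)) ?lerDr ?sqrtr_ge0 // => i Pi.
  by rewrite a0 // add0r.
have [B0|/null b0] := boolP (0 < B); last first.
  rewrite (eq_bigr (fun i => a i ^+ 2)) ?lerDl ?sqrtr_ge0 // => i Pi.
  by rewrite b0 // addr0.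
have AB : 0 <= A + B by rewrite addr_ge0 // ltW.
rewrite -(ger0_norm AB) -sqrtr_sqr ler_wsqrtr //.
have -> : (A + B) ^+ 2 =
    \sum_(i | P i) (A + B) * (a i ^+ 2 / A + b i ^+ 2 / B).
  rewrite -mulr_sumr big_split -!mulr_suml /=.
  rewrite -(sqr_sqrtr (sum0 a)) -(sqr_sqrtr (sum0 b)) -/A -/B.
  by field; rewrite !gt_eqF.
apply: ler_sum => i Pi; rewrite -subr_ge0.
have -> : (A + B) * (a i ^+ 2 / A + b i ^+ 2 / B) - (a i + b i) ^+ 2 =
    (a i * B - b i * A) ^+ 2 / (A * B) by field; rewrite !gt_eqF.
by rewrite divr_ge0 ?sqr_ge0 // mulr_ge0 // ltW.
Qed.

(** * Fair coins and Riesz products *)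

Section Coins.
Variable R : realType.
Implicit Types (e : nat -> bool) (al be : nat -> R).

Definition set_coin e k b : nat -> bool := fun j => if j == k then b else e j.

Definition coin_sign (b : bool) : R := if b then 1 else -1.

(** Expectation over the first [N] coins; all later coins are fixed at [false]. *)
Fixpoint coin_mean (N : nat) (f : (nat -> bool) -> R) : R :=
  if N is M.+1 then
    (coin_mean M (fun e => f (set_coin e M true)) +
     coin_mean M (fun e => f (set_coin e M false))) / 2
  else f (fun=> false).

(* Real and imaginary parts of the Riesz product
   [\prod_(k < N) (1 + 'i * al k * coin_sign (e k))]. *)
Fixpoint riesz al e (N : nat) : R * R :=
  if N is M.+1 then
    let: (x, y) := riesz al e M in
    let c := al M * coin_sign (e M) in (x - c * y, y + c * x)
  else (1, 0).

Lemma coin_mean_ext N f g : f =1 g -> coin_mean N f = coin_mean N g.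
Proof. by move=> fg; congr (coin_mean N); exact: funext. Qed.

Lemma coin_meanD N f g :
  coin_mean N (fun e => f e + g e) = coin_mean N f + coin_mean N g.
Proof. by elim: N f g => [|N IH] f g //=; rewrite !IH; field. Qed.

Lemma coin_meanZ N a f : coin_mean N (fun e => a * f e) = a * coin_mean N f.
Proof. by elim: N f => [|N IH] f //=; rewrite !IH; field. Qed.

Lemma coin_meanS N f : coin_mean N.+1 f =
  coin_mean N (fun e => (f (set_coin e N true) + f (set_coin e N false)) / 2).
Proof.
rewrite [LHS]/= -coin_meanD [RHS](_ : _ =
  coin_mean N (fun e => 2^-1 * (f (set_coin e N true) + f (set_coin e N false)))).
  by rewrite coin_meanZ mulrC.
by apply: coin_mean_ext => e; rewrite mulrC.
Qed.

Lemma coin_mean_cst N a : coin_mean N (fun=> a) = a.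
Proof. by elim: N => [|N IH] //=; rewrite IH; field. Qed.

Lemma coin_mean_sum N (I : Type) (r : seq I) (f : I -> (nat -> bool) -> R) :
  coin_mean N (fun e => \sum_(i <- r) f i e) = \sum_(i <- r) coin_mean N (f i).
Proof.
elim: r => [|i r IH].
  rewrite big_nil -[RHS](coin_mean_cst N 0).
  by apply: coin_mean_ext => e; rewrite big_nil.
rewrite big_cons -IH -coin_meanD.
by apply: coin_mean_ext => e; rewrite big_cons.
Qed.

Lemma le_coin_mean N f g : (forall e, f e <= g e) -> coin_mean N f <= coin_mean N g.
Proof.
elim: N f g => [|N IH] f g fg //=.
by rewrite ler_pM2r ?invr_gt0 // lerD // IH.
Qed.

Lemma riesz_ext al e e' N : (forall k, (k < N)%N -> al k = 0 \/ e k = e' k) ->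
  riesz al e N = riesz al e' N.
Proof.
elim: N => [|N IH] h //=.
rewrite -IH; last by move=> k kN; apply: h; rewrite ltnS ltnW.
case: (riesz al e N) => x y.
by case: (h N (ltnSn N)) => ->; rewrite ?mul0r.
Qed.

Lemma riesz_set_coin al e N b : riesz al (set_coin e N b) N = riesz al e N.
Proof.
by apply: riesz_ext => k kN; right; rewrite /set_coin ltn_eqF.
Qed.

Lemma riesz_set_coinS al e N b : riesz al (set_coin e N b) N.+1 =
  let: (x, y) := riesz al e N in
  let c := al N * coin_sign b in (x - c * y, y + c * x).
Proof. by rewrite /= riesz_set_coin /set_coin eqxx. Qed.

(** The squared modulus is the product of the [1 + al k ^+ 2], and [(1 + a) * (1 - u - a) <= 1 - u]
    for [a, u >= 0]. *)
Lemma riesz_norm al e N :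
  ((riesz al e N).1 ^+ 2 + (riesz al e N).2 ^+ 2) *
    (1 - \sum_(k < N) al k ^+ 2) <= 1.
Proof.
elim: N => [|N]; first by rewrite big_ord0 /=; lra.
rewrite big_ord_recr /=; case: (riesz al e N) => x y /= IH.
set u := \sum_(i < N) al i ^+ 2 in IH *.
have cc : coin_sign (e N) ^+ 2 = 1 by rewrite /coin_sign; case: (e N); ring.
have -> : (x - al N * coin_sign (e N) * y) ^+ 2 +
    (y + al N * coin_sign (e N) * x) ^+ 2 =
    (x ^+ 2 + y ^+ 2) * (1 + al N ^+ 2 * coin_sign (e N) ^+ 2) by ring.
have u0 : 0 <= u by apply: sumr_ge0 => k _; exact: sqr_ge0.
rewrite cc mulr1; apply: le_trans IH; rewrite -mulrA ler_wpM2l //.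
  by rewrite addr_ge0 ?sqr_ge0.
have a0 := sqr_ge0 (al N).
have := mulr_ge0 a0 u0; have := mulr_ge0 a0 a0; lra.
Qed.

(** The squared modulus is at most 4, so half the imaginary part can serve as a bias in [-1, 1]. *)
Lemma riesz_im_bound al e N : \sum_(k < N) al k ^+ 2 <= 3 / 4 ->
  `|(riesz al e N).2 / 2| <= 1.
Proof.
move=> h; have := riesz_norm al e N.
case: (riesz al e N) => x y /=; set u := \sum_(k < N) _ in h * => h2.
have x0 := sqr_ge0 x; have y0 := sqr_ge0 y.
have h3 : 0 <= (x ^+ 2 + y ^+ 2) * (3 / 4 - u) by rewrite mulr_ge0 //; lra.
rewrite ler_norml; apply/andP; split; nra.
Qed.

(* The imaginary part is odd in the coins [k] with [al k <> 0]. *)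
Lemma coin_mean_indep al N (h : (nat -> bool) -> R) :
  (forall k e b, al k != 0 -> h (set_coin e k b) = h e) ->
  coin_mean N (fun e => h e * (riesz al e N).2) = 0.
Proof.
elim: N h => [|N IH] h hh; first by rewrite /= mulr0.
have hN b k e c : al k != 0 -> h (set_coin (set_coin e k c) N b) = h (set_coin e N b).
  move=> ak; have [->|kN] := eqVneq k N.
    by congr h; apply: funext => j; rewrite /set_coin; case: eqP.
  have -> : set_coin (set_coin e k c) N b = set_coin (set_coin e N b) k c.
    apply: funext => j; rewrite /set_coin; case: (eqVneq j N) => [->|//].
    by rewrite eq_sym (negbTE kN).
  exact: hh.
have H b : coin_mean N (fun e => h (set_coin e N b) * (riesz al e N).2) = 0.
  by apply: IH => k e c; exact: hN.
transitivity (coin_mean N (fun e =>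
  2^-1 * (h (set_coin e N true) * (riesz al e N).2 +
          h (set_coin e N false) * (riesz al e N).2))); last first.
  by rewrite coin_meanZ coin_meanD !H addr0 mulr0.
rewrite coin_meanS; apply: coin_mean_ext => e.
rewrite !riesz_set_coinS; case: (riesz al e N) => x y /=.
(* Either coin [N] does not enter the product, or [h] ignores it and its two signs cancel. *)
have [->|aN] := eqVneq (al N) 0; first by rewrite !mul0r !addr0 mulrC.
by rewrite !hh // /coin_sign; field.
Qed.

(** With [c = al N * be N], one more coin turns the means [P] (imaginary parts) and [Q] (real parts)
    into [P + c * Q] and [Q + c * P]; hence the joint induction with [1 <= Q]. *)
Lemma coin_mean_riesz al be N :
  (forall k, 0 <= al k) -> (forall k, 0 <= be k) ->
  \sum_(k < N) al k * be k <=
  coin_mean N (fun e => (riesz al e N).2 * (riesz be e N).2).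
Proof.
move=> al0 be0.
suff [] : \sum_(k < N) al k * be k <=
  coin_mean N (fun e => (riesz al e N).2 * (riesz be e N).2) /\
  1 <= coin_mean N (fun e => (riesz al e N).1 * (riesz be e N).1) by [].
elim: N => [|N [IH1 IH2]]; first by rewrite big_ord0 /=; split; lra.
have s0 : 0 <= \sum_(k < N) al k * be k.
  by apply: sumr_ge0 => k _; rewrite mulr_ge0.
have ab : 0 <= al N * be N by rewrite mulr_ge0.
set P := coin_mean N _ in IH1; set Q := coin_mean N _ in IH2.
have -> : coin_mean N.+1 (fun e => (riesz al e N.+1).2 * (riesz be e N.+1).2) =
    P + al N * be N * Q.
  rewrite coin_meanS -coin_meanZ -coin_meanD; apply: coin_mean_ext => e.
  rewrite !riesz_set_coinS; case: (riesz al e N) (riesz be e N) => x y [z w] /=.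
  by rewrite /coin_sign; field.
have -> : coin_mean N.+1 (fun e => (riesz al e N.+1).1 * (riesz be e N.+1).1) =
    Q + al N * be N * P.
  rewrite coin_meanS -coin_meanZ -coin_meanD; apply: coin_mean_ext => e.
  rewrite !riesz_set_coinS; case: (riesz al e N) (riesz be e N) => x y [z w] /=.
  by rewrite /coin_sign; field.
rewrite big_ord_recr /=.
have P0 : 0 <= al N * be N * P by rewrite mulr_ge0 // (le_trans s0).
have Q1 : 0 <= al N * be N * (Q - 1) by rewrite mulr_ge0 // subr_ge0.
by split; lra.
Qed.

End Coins.

(** * Chains, maximal orders and the placement of coin blocks *)

Section Orders.
Variables (T : nat) (S : tfg T).
Hypothesis S_irr : is_tfg S.

Lemma is_order_uniq s : is_order S s -> uniq s.
Proof. by apply: pairwise_uniq => t; apply/negbTE. Qed.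

Lemma is_order_size s : is_order S s -> (size s <= T)%N.
Proof. by move=> /is_order_uniq /card_uniqP <-; rewrite -[leqRHS]card_ord max_card. Qed.

(** Orders have no repetitions, so their length is at most [T] and proper extension must stop. *)
Lemma extend_maximal_order s : is_order S s ->
  exists2 s', is_maximal_order S s' & subseq s s'.
Proof.
have [n] := ubnP (T - size s); elim: n s => // n IH s sn os.
have [max|] := EM (is_maximal_order S s); first by exists s.
move=> /not_andP[//|/existsNP[s' /not_implyP[os' /not_implyP[ss' /eqP ne]]]].
have lt : (size s < size s')%N.
  by rewrite (ltn_leqif (size_subseq_leqif ss')) eq_sym.
have ls' := is_order_size s' os'.
have [|s'' ms'' sub] := IH s' _ os'; first by move: sn lt ls'; lia.
by exists s'' => //; exact: subseq_trans ss' sub.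
Qed.

Definition chain_set (B : {set 'I_T}) : bool :=
  `[< exists s, is_order S s /\ B = [set x in s] >].

Lemma chain_set_extend B : chain_set B ->
  exists2 C, maxorder_set S C & B \subset C.
Proof.
move=> /asboolP[s [os ->]]; have [s' ms' /mem_subseq ss'] := extend_maximal_order s os.
exists [set x in s']; first by apply/asboolP; exists s'.
by apply/subsetP => x; rewrite !inE => /ss'.
Qed.

Lemma chain_set0 : chain_set set0.
Proof. by apply/asboolP; exists [::]; split=> //; apply/setP => x; rewrite !inE. Qed.

Lemma chain_setU1 B t : chain_set B -> B \subset S t -> chain_set (t |: B).
Proof.
move=> /asboolP[s [os ->]] /subsetP sub; apply/asboolP; exists (rcons s t); split.
  rewrite /is_order pairwise_rcons -/(is_order S s) os andbT.
  by apply/allP => x xs; apply: sub; rewrite inE.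
by apply/setP => x; rewrite !inE mem_rcons inE.
Qed.

Lemma maxorder_set_cover t : exists2 C, maxorder_set S C & t \in C.
Proof.
have [] := chain_set_extend (t |: set0).
  by apply: chain_setU1; [exact: chain_set0|exact: sub0set].
by move=> C mC; rewrite subUset sub1set => /andP[tC _]; exists C.
Qed.

Variable n : 'I_T -> nat.

(** Weight of the heaviest chain inside [S t]; it will be the first coin of the block of [t], which
    has length [n t]. *)
Definition weight_before (t : 'I_T) : nat :=
  \max_(B : {set 'I_T} | chain_set B && (B \subset S t)) \sum_(x in B) n x.

Lemma weight_before_leq t b :
  (forall B : {set 'I_T}, chain_set B -> B \subset S t ->
    \sum_(x in t |: B) n x <= b)%N ->
  (weight_before t + n t <= b)%N.
Proof.
move=> h; have sumU (B : {set 'I_T}) : B \subset S t ->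
    (\sum_(x in t |: B) n x = n t + \sum_(x in B) n x)%N.
  move=> /subsetP sub; rewrite big_setU1 //.
  by apply: contraNN (S_irr t) => /sub.
have [B /andP[cB sB] ->] :
    {B | chain_set B && (B \subset S t) & weight_before t = \sum_(x in B) n x}%N.
  apply: eq_bigmax_cond; apply/card_gt0P; exists set0.
  by rewrite unfold_in chain_set0 sub0set.
by rewrite addnC -sumU //; exact: h.
Qed.

(** A chain below [s], extended by [s], is a chain below [t]. This makes blocks of comparable rounds
    disjoint. *)
Lemma weight_before_step (s t : 'I_T) : S s \subset S t -> s \in S t ->
  (weight_before s + n s <= weight_before t)%N.
Proof.
move=> sub st; apply: weight_before_leq => B cB sB.
apply: leq_bigmax_cond; rewrite chain_setU1 //= subUset sub1set st.
exact: subset_trans sB sub.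
Qed.

(** A chain below [t], extended by [t], lies in a maximal order; so every block fits among the first
    [b] coins. *)
Lemma weight_before_max t b :
  (forall C, maxorder_set S C -> \sum_(x in C) n x <= b)%N ->
  (weight_before t + n t <= b)%N.
Proof.
move=> h; apply: weight_before_leq => B cB sB.
have [C mC sub] := chain_set_extend _ (chain_setU1 _ _ cB sB).
apply: leq_trans (h C mC).
by rewrite [leqRHS](big_setID (t |: B)) /= (setIidPr sub) leq_addr.
Qed.

End Orders.

(** * Dual weights for the program [UB] *)

Section Duality.
Variables (R : realType) (T : nat) (S : tfg T).
Hypothesis S_irr : is_tfg S.
Implicit Types (lam : {set 'I_T} -> 'I_T -> R) (z : 'rV[R]_T).

Definition relaxed_feasible z lam : Prop :=
  [/\ forall t, z 0 t <= \sum_(C | maxorder_set S C) lam C t,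
      forall C t, maxorder_set S C -> t \notin C -> lam C t = 0 &
      forall C t, maxorder_set S C -> 0 <= lam C t].

(* With [>=] in place of [=], shrinking [lam] shows that the value at [z = 1] is
   still [UB], and the value becomes a sublinear function of [z]. *)
Definition relaxed_UB z : R :=
  inf [set UB_obj S lam | lam in relaxed_feasible z]%classic.

Lemma UB_obj_ge0 lam : 0 <= UB_obj S lam.
Proof. by apply: sumr_ge0 => C _; exact: sqrtr_ge0. Qed.

Lemma relaxed_UB_le z lam : relaxed_feasible z lam -> relaxed_UB z <= UB_obj S lam.
Proof.
move=> fl; apply: ge_inf; last by exists lam.
by exists 0 => _ [l _ <-]; exact: UB_obj_ge0.
Qed.

Lemma le_relaxed_UB z b :
  (forall lam, relaxed_feasible z lam -> b <= UB_obj S lam) -> b <= relaxed_UB z.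
Proof.
move=> h; apply: lb_le_inf => [|_ [lam fl <-]]; last exact: h.
(* The feasible set must be nonempty for the infimum: every maximal order through [t] gets the full
   [|z 0 t|]. *)
pose lam (C : {set 'I_T}) (t : 'I_T) : R := if t \in C then `|z 0 t| else 0.
exists (UB_obj S lam), lam => //; split=> [t|C t _ /negbTE tC|C t _].
- have [C mC tC] := maxorder_set_cover T S S_irr t.
  rewrite (bigD1 C) //= {1}/lam tC (le_trans (ler_norm _)) // lerDl.
  by apply: sumr_ge0 => D _; rewrite /lam; case: ifP.
- by rewrite /lam tC.
- by rewrite /lam; case: ifP.
Qed.

(** Solutions add and scale with their demands, and the objective is a sum of Euclidean norms. *)
Lemma sublinear_relaxed_UB : sublinear R 'rV[R]_T relaxed_UB.
Proof.
split=> [x y|a x].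
  rewrite -lerBlDr; apply: le_relaxed_UB => l [l1 l2 l3].
  rewrite lerBlDr -lerBlDl; apply: le_relaxed_UB => m [m1 m2 m3].
  rewrite lerBlDl; apply: (@le_trans _ _ (UB_obj S (fun C t => l C t + m C t))).
    apply: relaxed_UB_le; split=> [t|C t mC tC|C t mC].
    - by rewrite big_split mxE lerD.
    - by rewrite l2 // m2 // addr0.
    - by rewrite addr_ge0 ?l3 ?m3.
  by rewrite /UB_obj -big_split; apply: ler_sum => C _; exact: sqrt_sum_sqrD.
rewrite le_eqVlt => /predU1P[<-|a0].
  rewrite scale0r mul0r; apply: (@le_trans _ _ (UB_obj S (fun=> fun=> 0))).
    apply: relaxed_UB_le; split=> // t; rewrite mxE big1 //.
  rewrite /UB_obj big1 // => C _; rewrite big1 ?sqrtr0 // => t _.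
  by rewrite expr0n.
rewrite -ler_pdivrMl //; apply: le_relaxed_UB => l [l1 l2 l3]; rewrite ler_pdivrMl //.
apply: (@le_trans _ _ (UB_obj S (fun C t => a * l C t))).
  apply: relaxed_UB_le; split=> [t|C t mC tC|C t mC].
  - by rewrite mxE -mulr_sumr ler_pM2l.
  - by rewrite l2 // mulr0.
  - by rewrite mulr_ge0 ?l3 // ltW.
rewrite /UB_obj mulr_sumr; apply: ler_sum => C _.
under eq_bigr do rewrite exprMn.
by rewrite -mulr_sumr sqrtrM ?sqr_ge0 // sqrtr_sqr ger0_norm // ltW.
Qed.

Lemma UB_le_relaxed_UB : UB R S <= relaxed_UB (const_mx 1).
Proof.
apply: le_relaxed_UB => l [l1 l2 l3].
pose s t := \sum_(C | maxorder_set S C) l C t.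
have s1 t : 1 <= s t by have := l1 t; rewrite mxE.
have s0 t : 0 < s t by apply: lt_le_trans (s1 t).
apply: (@le_trans _ _ (UB_obj S (fun C t => l C t / s t))).
  apply: ge_inf; first by exists 0 => _ [? _ <-]; exact: UB_obj_ge0.
  exists (fun C t => l C t / s t) => //; split=> [t|]; last split=> [C t mC tC|C t mC].
  - by rewrite -mulr_suml -/(s t) divff ?gt_eqF.
  - by rewrite l2 // mul0r.
  - by rewrite divr_ge0 ?l3 // ltW.
apply: ler_sum => C mC; apply: ler_wsqrtr; apply: ler_sum => t _.
rewrite ler_sqr ?nnegrE ?l3 //; last by rewrite divr_ge0 ?l3 // ltW.
by rewrite ler_pdivrMr // ler_peMr ?l3.
Qed.

(** Serve the whole demand from the single order [C]. *)
Lemma relaxed_UB_chain C z : maxorder_set S C -> (forall t, 0 <= z 0 t) ->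
  (forall t, t \notin C -> z 0 t = 0) ->
  relaxed_UB z <= Num.sqrt (\sum_(t in C) z 0 t ^+ 2).
Proof.
move=> mC z0 zC.
apply: (@le_trans _ _ (UB_obj S (fun D t => if D == C then z 0 t else 0))).
  apply: relaxed_UB_le; split=> [t|D t _|D t _]; last by case: ifP.
  - rewrite (bigD1 C) //= eqxx lerDl; apply: sumr_ge0 => D _.
    by case: ifP.
  - by case: eqP => // -> /zC.
rewrite /UB_obj (bigD1 C) //= eqxx [X in _ + X]big1 ?addr0 // => D /andP[_ /negbTE ->].
by rewrite big1 ?sqrtr0 // => t _; rewrite expr0n.
Qed.

Lemma UB_dual : exists y : 'I_T -> R,
  [/\ forall t, 0 <= y t,
      forall C, maxorder_set S C -> \sum_(t in C) y t ^+ 2 <= 1 &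
      UB R S <= \sum_t y t].
Proof.
have [q [sq qp q1 lq]] := hahn_banach_seq R 'rV[R]_T relaxed_UB (const_mx 1)
  [seq delta_mx 0 t | t : 'I_T] sublinear_relaxed_UB.
have {}lq t : linear_along R 'rV[R]_T q (delta_mx 0 t).
  by apply: lq; apply: image_f.
have qE z : q z = \sum_t z 0 t * q (delta_mx 0 t).
  by rewrite {1}(row_sum_delta z) linear_along_sum.
have y0 t : 0 <= q (delta_mx 0 t).
  (* The demand [- delta_mx 0 t] is met by the zero solution, at no cost. *)
  rewrite -oppr_le0 -lq; apply: le_trans (qp _) _.
  have -> : 0 = UB_obj S (fun=> fun=> 0) :> R.
    by rewrite /UB_obj big1 // => C _; rewrite big1 ?sqrtr0 // => ? _; rewrite expr0n.
  apply: relaxed_UB_le; split=> // r; rewrite big1 // !mxE oppr_le0.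
  by case: (_ && _).
exists (fun t => q (delta_mx 0 t)); split=> // [C mC|]; last first.
  apply: le_trans UB_le_relaxed_UB _; rewrite -q1 qE.
  by apply: ler_sum => t _; rewrite mxE mul1r.
set x := \sum_(t in C) _.
(* Test on the dual weights restricted to [C]: there [q z = x] while [relaxed_UB z <= Num.sqrt x],
   which forces [x <= 1]. *)
pose z : 'rV[R]_T := \row_t if t \in C then q (delta_mx 0 t) else 0.
have x0 : 0 <= x by apply: sumr_ge0 => t _; exact: sqr_ge0.
have xz : x = q z.
  rewrite qE /x big_mkcond; apply: eq_bigr => t _.
  by rewrite mxE; case: ifP => _; rewrite ?mul0r ?expr2.
have : x <= Num.sqrt x.
  have -> : Num.sqrt x = Num.sqrt (\sum_(t in C) z 0 t ^+ 2).
    by congr Num.sqrt; apply: eq_bigr => t tC; rewrite mxE tC.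
  rewrite xz; apply: le_trans (qp z) _; apply: relaxed_UB_chain => // t.
    by rewrite mxE; case: ifP.
  by rewrite mxE => /negbTE ->.
move=> h; have := sqr_sqrtr x0; have s0 := sqrtr_ge0 x.
by move: h s0; set s := Num.sqrt x; nra.
Qed.

End Duality.

(** * Lower bounds on the worst-case regret from one loss sequence and one comparator *)

Section Regret.
Variables (R : realType) (T K : nat).
Implicit Types (l : 'I_T -> 'I_K -> R) (x : 'I_K -> R).

Lemma inner_bounds x (l : 'I_K -> R) : in_simplex x ->
  (forall k, 0 <= l k <= 1) -> 0 <= inner x l <= 1.
Proof.
move=> [x0 x1] l01; apply/andP; split.
  by apply: sumr_ge0 => k _; rewrite mulr_ge0 //; case/andP: (l01 k).
rewrite -x1; apply: ler_sum => k _; rewrite ler_piMr //.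
by case/andP: (l01 k).
Qed.

(** The work is to bound the sets: regrets are at most [T] and comparator losses nonnegative, so
    [sup] and [inf] are genuine bounds. *)
Lemma le_Reg (S : tfg T) (A : algorithm R T K) l x :
  is_S_learning S A -> loss_seq l -> in_simplex x ->
  \sum_t (inner (A t l) (l t) - inner x (l t)) <= Reg A.
Proof.
move=> [Asim _] ll sx.
have lb l' : loss_seq l' ->
    lbound [set \sum_t inner xs (l' t) | xs in @in_simplex R K]%classic 0.
  move=> ll' _ [xs sxs <-]; apply: sumr_ge0 => t _.
  by case/andP: (inner_bounds _ _ sxs (ll' t)).
have : regret A l <= Reg A.
  apply: ub_le_sup; last by exists l.
  exists T%:R => _ [l' ll' <-]; rewrite /regret lerBlDr.
  apply: (@le_trans _ _ T%:R).
    have -> : T%:R = \sum_(t < T) 1 :> R by rewrite sumr_const card_ord.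
    apply: ler_sum => t _.
    by case/andP: (inner_bounds _ _ (Asim t l' ll') (ll' t)).
  rewrite lerDl; apply: lb_le_inf; last exact: lb.
  by exists (\sum_t inner x (l' t)), x.
apply: le_trans; rewrite sumrB lerD2l lerN2.
by apply: ge_inf; [exists 0; exact: lb|exists x].
Qed.

End Regret.

(** * The random adversary built from Riesz products *)

Lemma Reg_riesz (R : realType) (T : nat) (S : tfg T) (A : algorithm R T 2)
    (N : nat) (al : 'I_T -> nat -> R) (be : nat -> R) :
  is_S_learning S A ->
  (forall t k, 0 <= al t k) -> (forall k, 0 <= be k) ->
  (forall t, \sum_(k < N) al t k ^+ 2 <= 3 / 4) -> \sum_(k < N) be k ^+ 2 <= 3 / 4 ->
  (forall s t k, s \in S t -> al t k != 0 -> al s k = 0) ->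
  1 / 8 * \sum_t \sum_(k < N) al t k * be k <= Reg A.
Proof.
move=> SA al0 be0 al1 be1 disj.
pose Z t e : R := (riesz R (al t) e N).2 / 2.
pose G e : R := (riesz R be e N).2 / 2.
pose two (a : R) (k : 'I_2) : R := if k == ord0 then (1 + a) / 2 else (1 - a) / 2.
pose l e t := two (Z t e).
have innerE x a : in_simplex x -> inner x (two a) = 1 / 2 + (x ord0 - x (lift ord0 ord0)) * a / 2.
  by move=> [_]; rewrite /inner !big_ord_recl !big_ord0 /two /=; lra.
have Zb t e : -1 <= Z t e <= 1 by rewrite -ler_norml; exact: riesz_im_bound.
have Gb e : -1 <= G e <= 1 by rewrite -ler_norml; exact: riesz_im_bound.
have ll e : loss_seq (l e).
  move=> t k; rewrite /l /two; have := Zb t e.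
  by case: ifP => _ /andP[h1 h2]; apply/andP; split; lra.
(* The sign is reversed because a positive [Z] makes the first action the costlier one. *)
have comp e : in_simplex (two (- G e)).
  split=> [k|].
    by rewrite /two; have := Gb e; case: ifP => _ /andP[h1 h2]; lra.
  by rewrite !big_ord_recl big_ord0 /two /=; lra.
pose h t e := A t (l e) ord0 - A t (l e) (lift ord0 ord0).
(* A coin in the block of [t] affects no loss visible at [t], by [disj]. *)
have hinv t k e b : al t k != 0 -> h t (set_coin e k b) = h t e.
  move=> ak; suff eqA i : A t (l (set_coin e k b)) i = A t (l e) i.
    by rewrite /h !eqA.
  apply: SA.2 => // s st j; rewrite /l /Z (riesz_ext R (al s) _ e) // => c _.
  rewrite /set_coin; case: eqP => [->|_]; last by right.
  by left; exact: disj st ak.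
have -> : 1 / 8 * (\sum_t \sum_(k < N) al t k * be k) =
    \sum_t 1 / 8 * \sum_(k < N) al t k * be k by rewrite mulr_sumr.
rewrite -(coin_mean_cst R N (Reg A)).
apply: (@le_trans _ _ (coin_mean R N (fun e =>
   \sum_t (inner (A t (l e)) (l e t) - inner (two (- G e)) (l e t))))); last first.
  by apply: le_coin_mean => e; exact: le_Reg SA _ _.
rewrite coin_mean_sum; apply: ler_sum => t _.
(* The first term, the learner's deviation from 1/2, has mean zero; the second is the comparator's
   gain. *)
rewrite (coin_mean_ext R N _ (fun e => 1 / 4 * (h t e * (riesz R (al t) e N).2) +
    1 / 8 * ((riesz R (al t) e N).2 * (riesz R be e N).2))); last first.
  move=> e; rewrite !innerE //; last exact: SA.1.
  by rewrite /h /two /= /Z /G; field.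
rewrite coin_meanD !coin_meanZ (coin_mean_indep R (al t) N (h t)); last exact: hinv.
by rewrite mulr0 add0r; apply: ler_wpM2l; [lra|exact: coin_mean_riesz].
Qed.

(** * Coin blocks for integer weights *)

Lemma Reg_chain_weights (R : realType) (T : nat) (S : tfg T) (A : algorithm R T 2)
    (m : 'I_T -> nat) (M : nat) :
  transitive_tfg S -> is_S_learning S A -> (0 < M)%N ->
  (forall C, maxorder_set S C -> \sum_(t in C) m t ^ 2 <= M ^ 2)%N ->
  1 / 32 * \sum_t (m t)%:R / M%:R <= Reg A.
Proof.
move=> [S_irr [_ S_trans]] SA M0 hm.
pose n t := (m t ^ 2)%N.
pose p := weight_before T S n.
have M0' : M%:R != 0 :> R by rewrite pnatr_eq0 -lt0n.
(* Over [m t ^ 2] coins the squares sum to 1/4 (0 if the block is empty), likewise for [be] over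
   [M ^ 2]; the products [al t k * be k] sum to [m t / (4 M)]. *)
pose al (t : 'I_T) (k : nat) : R :=
  if (p t <= k < p t + n t)%N then (2 * (m t)%:R)^-1 else 0.
pose be (k : nat) : R := (2 * M%:R)^-1.
have al_sum t (c : R) :
    \sum_(k < M ^ 2) (if (p t <= k < p t + n t)%N then c else 0) = (n t)%:R * c.
  have le_M : (p t + n t <= M ^ 2)%N by apply: weight_before_max.
  rewrite -(big_mkord xpredT (fun k => if (p t <= k < p t + n t)%N then c else 0)).
  rewrite (big_cat_nat (leq0n (p t))) /=; last by rewrite (leq_trans _ le_M) ?leq_addr.
  rewrite big_nat big1 ?add0r; last by move=> k /andP[_ kp]; rewrite leqNgt kp.
  rewrite (big_cat_nat (leq_addr (n t) (p t)) le_M) /=.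
  rewrite [X in _ + X]big_nat [X in _ + X]big1 ?addr0; last first.
    by move=> k /andP[kp _]; rewrite [X in _ && X]ltnNge kp andbF.
  rewrite big_nat (eq_bigr (fun=> c)) -?big_nat; last by move=> k ->.
  by rewrite sumr_const_nat addKn mulr_natl.
have := Reg_riesz R T S A (M ^ 2) al be SA.
have -> : 1 / 8 * (\sum_t \sum_(k < M ^ 2) al t k * be k) =
    1 / 32 * (\sum_t (m t)%:R / M%:R).
  rewrite !mulr_sumr; apply: eq_bigr => t _.
  rewrite -mulr_suml al_sum /be /n natrX.
  have [->|mt] := eqVneq (m t) 0%N; first by rewrite expr0n /= !mul0r !mulr0.
  by field; rewrite M0' pnatr_eq0.
apply.
- by move=> t k; rewrite /al; case: ifP => // _; rewrite invr_ge0 mulr_ge0.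
- by move=> k; rewrite invr_ge0 mulr_ge0.
- move=> t; rewrite (eq_bigr (fun k : 'I_(M ^ 2) =>
      if (p t <= k < p t + n t)%N then (2 * (m t)%:R)^-1 ^+ 2 else 0 : R)); last first.
    by move=> k _; rewrite /al; case: ifP; rewrite ?expr0n.
  rewrite al_sum /n natrX; have [->|mt] := eqVneq (m t) 0%N.
    by rewrite expr0n mul0r; lra.
  rewrite -[X in X <= _](_ : 1 / 4 = _); first by lra.
  by field; rewrite pnatr_eq0.
- rewrite /be sumr_const card_ord -[_ *+ (M ^ 2)]mulr_natl natrX.
  rewrite -[X in X <= _](_ : 1 / 4 = _); first by lra.
  by field.
- move=> s t k st; rewrite /al; case: ifP => [/andP[h1 _] _|]; last by rewrite eqxx.
  case: ifP => // /andP[_ h2].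
  have : (p s + n s <= p t)%N.
    apply: weight_before_step => //; apply/subsetP => r; exact: S_trans st.
  by move: h1 h2; lia.
Qed.

(** * Rounding the dual weights and choosing the precision *)

Theorem theorem13 (R : realType) (T : nat) (S : tfg T) (A : algorithm R T 2) :
  transitive_tfg S -> is_S_learning S A ->
  Reg A >= UB R S / 50.
Proof.
move=> St SA; have [y [y0 yC UBy]] := UB_dual R T S St.1.
have key M : (0 < M)%N -> 1 / 32 * (UB R S - T%:R / M%:R) <= Reg A.
  move=> M0; have M0' : 0 < M%:R :> R by rewrite ltr0n.
  (* Rounding down preserves the chain constraints and costs at most [1 / M] per round. *)
  pose m t := Num.truncn (M%:R * y t).
  have My0 t : 0 <= M%:R * y t by rewrite mulr_ge0.
  apply: le_trans (Reg_chain_weights R T S A m M St SA M0 _); last first.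
    move=> C mC; rewrite -(ler_nat R) natr_sum natrX.
    apply: (@le_trans _ _ (\sum_(t in C) M%:R ^+ 2 * y t ^+ 2)).
      apply: ler_sum => t _; rewrite natrX -exprMn ler_sqr ?nnegrE //.
      by have /andP[] := truncn_itv (My0 t).
    by rewrite -mulr_sumr ler_piMr ?sqr_ge0 // yC.
  apply: ler_wpM2l; first by lra.
  rewrite lerBlDr; apply: le_trans UBy _.
  have -> : T%:R / M%:R = \sum_(t < T) 1 / M%:R :> R.
    by rewrite -mulr_suml sumr_const card_ord.
  rewrite -big_split; apply: ler_sum => t _ /=.
  rewrite -mulrDl ler_pdivlMr // mulrC natr1.
  by have /andP[_ /ltW] := truncn_itv (My0 t).
have [U0|U0] := leP (UB R S) 0.
  (* All weights zero already give [0 <= Reg A]. *)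
  apply: (@le_trans _ _ 0); first by lra.
  have := Reg_chain_weights R T S A (fun=> 0%N) 1 St SA (ltn0Sn 0).
  rewrite big1 ?mulr0 => [|t _]; last by rewrite mul0r.
  by apply=> C _; rewrite big1.
(* The admissible rounding loss: [1 / 32 * (1 - 9 / 25) = 1 / 50]. *)
pose b := 9 / 25 * UB R S.
have b0 : 0 < b by rewrite mulr_gt0 // divr_gt0.
have Tb0 : 0 <= T%:R / b by rewrite divr_ge0 // ltW.
have /andP[_ ] := truncn_itv Tb0; set M := (Num.truncn _).+1 => TM.
apply: le_trans (key M (ltn0Sn _)).
have : T%:R / M%:R <= b.
  by rewrite ler_pdivrMr ?ltr0n // mulrC -ler_pdivrMr // ltW.
by rewrite /b; lra.
Qed.
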